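(* Suppose that the filtration satisfies the usual conditions and let $R=(R_t)_{t\in[0,T]}$ be a stopping problem. Then $\gamma(R;\mu)=\gamma(R;\rho)$ whenever the mixed stopping time $\mu$ and the randomized stopping time $\rho$ are equivalent. Moreover, $\gamma(R;\mu)=\gamma(R;\delta_\mu)$ and $\gamma(R;\rho)=\gamma(R;\delta_\rho)$ for every mixed stopping time $\mu$ and every randomized stopping time $\rho$.
   Context: $T>0$; $I=[0,1]$ is equipped with its Borel $\sigma$-algebra $\mathcal{B}$ and Lebesgue measure $\lambda$. $(\Omega,\mathcal{F},P)$ is a probability space with filtration $(\mathcal{F}_t)_{t\in[0,T]}$. The filtration satisfies the usual conditions if $\mathcal{F}=\bigvee_{t\in[0,T]}\mathcal{F}_t$; $\mathcal{F}_0$ contains all $P$-null sets; and $\mathcal{F}_t=\bigcap_{s>t}\mathcal{F}_s$ (right continuity). In the definitions of stopping times, measurability with respect to a $\sigma$-algebra means with respect to its completion under the underlying measure ($P$ on $\Omega$, $P\otimes\lambda$ on $\Omega\times I$). A mixed stopping time is a function $\mu:\Omega\times I\to[0,T]$ such that $\{(\omega,r)\in\Omega\times I:\mu(\omega,r)\le t\}$ is $(\mathcal{F}_t\otimes\mathcal{B})$-measurable for every $t\in[0,T]$. A randomized stopping time is an adapted $[0,1]$-valued process $\rho=(\rho_t)_{t\in[0,T]}$ with right-continuous nondecreasing paths and $\rho_T\equiv 1$. A distribution stopping time is a probability measure $\delta$ on $\Omega\times[0,T]$ (with product $\sigma$-algebra $\mathcal{F}\otimes$ Borel) whose marginal on $\Omega$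 is $P$ and such that for every $t\in[0,T]$ the Radon-Nikodym derivative with respect to $P$ of $\delta^t(A):=\delta(A\times[0,t])$, $A\in\mathcal{F}$, is $\mathcal{F}_t$-measurable. A mixed stopping time $\mu$ defines the distribution stopping time $\delta_\mu$, the push-forward of $P\otimes\lambda$ under $(\omega,r)\mapsto(\omega,\mu(\omega,r))$. A randomized stopping time $\rho$ defines the distribution stopping time $\delta_\rho$ by $\delta_\rho(A\times[0,t])=\int_A\rho_t(\omega)\,P(d\omega)$ for all $t\in[0,T]$, $A\in\mathcal{F}$. $\mu$ and $\rho$ are equivalent if $\delta_\mu=\delta_\rho$. A stopping problem is a bounded process $R=(R_t)_{t\in[0,T]}$ such that $(\omega,t)\mapsto R_t(\omega)$ is a real-valued function measurable with respect to the product of $\mathcal{F}$ and the Borel $\sigma$-algebra of $[0,T]$. Payoffs are $\gamma(R;\mu)=\mathbf{E}_{P\otimes\lambda}[R_{\mu(\omega,r)}(\omega)]$ for a mixed stopping time $\mu$; $\gamma(R;\rho)=\mathbf{E}_P\left[\int_0^T R_t(\omega)\,d\rho_t(\omega)\right]$ for a randomized stopping time $\rho$, where the Lebesgue-Stieltjes integral is over $[0,T]$ including the atom of mass $\rho_0(\omega)$ at $t=0$ (i.e. it is the integral against the probability measure on $[0,T]$ with c.d.f. $t\mapsto\rho_t(\omega)$); $\gamma(R;\delta)=\mathbf{E}_\delta[R_t(\omega)]=\int R_t(\omega)\,\delta(d\omega,dt)$ for a distribution stopping time $\delta$. *)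

(* Defs.v *)
From HB Require Import structures.
From mathcomp Require Import all_boot all_order all_algebra.
From mathcomp Require Import all_classical all_reals all_analysis.
From mathcomp Require Import measurable_realfun.

Set Implicit Arguments.
Unset Strict Implicit.
Unset Printing Implicit Defensive.

Import Order.TTheory GRing.Theory Num.Theory.
Import numFieldNormedType.Exports.

Local Open Scope classical_set_scope.
Local Open Scope ring_scope.

(* Processes, stopping times and measures live on the ambient spaces [R] and
   [Omega * R]; only their behaviour over the time interval [`[0, T]] and the
   randomisation interval [`[0, 1]] is constrained. *)

(* The sets [A `|` N] with [A] in [<<s G >>] and [N] contained in an [m]-null
   member of [<<s G >>] (not merely in a null set of the ambient algebra). *)
Definition completion (T : pointedType) (R : realType) (G : set (set T))
    (m : set T -> \bar R) : set (set T) :=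
  @completed_algebra_gen _ (g_sigma_algebraType G) R m.

Definition prod_borel (T : Type) (R : realType) (G : set (set T)) :
    set (set (T * R)) :=
  <<s [set A `*` B | A in G & B in @measurable _ R] >>.

Arguments prod_borel {T} R G.

Section lebesgue01.
Context {R : realType}.

(* Lebesgue measure on [`[0, 1]], as a probability on [R]. *)
Definition lebesgue01 : set R -> \bar R :=
  mrestr (@lebesgue_measure R) (@measurable_itv R `[0, 1]).

Let mu : {measure set (measurableTypeR R) -> \bar R} :=
  mrestr (@lebesgue_measure R) (@measurable_itv R `[0, 1]).

(* [measurableTypeR R] and [R] have convertible sigma-algebras but different
   displays, so the instances are transported by hand. *)
HB.instance Definition _ := isMeasure.Build _ R R lebesgue01
  (@measure0 _ _ _ mu) (@measure_ge0 _ _ _ mu)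
  (@measure_semi_sigma_additive _ _ _ mu).

Let lebesgue01_setT : lebesgue01 setT = 1%E.
Proof.
by rewrite /lebesgue01 /mrestr setTI lebesgue_measure_itv /= lte01 oppr0 adde0.
Qed.

HB.instance Definition _ :=
  @Measure_isProbability.Build _ _ R lebesgue01 lebesgue01_setT.

End lebesgue01.

Section stopping_times.
Context {d : measure_display} {Omega : measurableType d} {R : realType}.
Variables (P : probability Omega R) (T : R).

Record filtration := Filtration {
  filtration_sets :> R -> set (set Omega);
  filtration_sigma : forall t, 0 <= t <= T ->
    sigma_algebra setT (filtration_sets t);
  filtration_sub : forall t, 0 <= t <= T ->
    filtration_sets t `<=` measurable;
  filtration_le : forall s t, 0 <= s -> s <= t -> t <= T ->
    filtration_sets s `<=` filtration_sets t }.

(* Null sets are arbitrary subsets of measurable sets of measure zero; at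
   [t = T] there is no later time, so right continuity is void. *)
Definition usual_conditions (F : filtration) : Prop :=
  [/\ @measurable _ Omega = <<s \bigcup_(t in `[0, T]) F t >>,
      P.-negligible `<=` F 0 &
      forall t, 0 <= t < T -> F t = \bigcap_(s in `]t, T]) F s].

Definition PxLebesgue : set (Omega * R) -> \bar R := (P \x lebesgue01)%E.
HB.instance Definition _ := Measure.on PxLebesgue.

(* Caratheodory's sigma-algebra for the outer measure of a finite measure is
   the completion of the original sigma-algebra. *)
Definition completed_space := caratheodory_type (PxLebesgue^*)%mu.
HB.instance Definition _ := Measurable.on completed_space.

Definition completed_PxLebesgue : set completed_space -> \bar R :=
  @completed_measure_extension _ _ R PxLebesgue.
HB.instance Definition _ := Measure.on completed_PxLebesgue.
Let completed_setT : completed_PxLebesgue setT = 1%E.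
Proof.
rewrite /completed_PxLebesgue /completed_measure_extension.
rewrite measurable_mu_extE//=.
exact: (@probability_setT _ _ _ (P \x lebesgue01)%E).
Qed.
HB.instance Definition _ :=
  @Measure_isProbability.Build _ _ R completed_PxLebesgue completed_setT.

Record mixed_stopping_time (F : filtration) := MixedStoppingTime {
  mixed_fun :> Omega * R -> R;
  mixed_range : forall w r, 0 <= r <= 1 -> 0 <= mixed_fun (w, r) <= T;
  mixed_measurable : forall t, 0 <= t <= T ->
    completion (prod_borel R (F t)) PxLebesgue
      [set p | 0 <= p.2 <= 1 /\ mixed_fun p <= t] }.

(* All conditions hold for every [w], not just almost surely. *)
Record randomized_stopping_time (F : filtration) := RandomizedStoppingTime {
  randomized_fun :> R -> Omega -> R;
  randomized_range : forall t w, 0 <= t <= T -> 0 <= randomized_fun t w <= 1;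
  randomized_adapted : forall t, 0 <= t <= T ->
    forall B, measurable B -> completion (F t) P (randomized_fun t @^-1` B);
  randomized_nondecreasing : forall w s t, 0 <= s -> s <= t -> t <= T ->
    randomized_fun s w <= randomized_fun t w;
  randomized_right_continuous : forall w t, 0 <= t < T ->
    randomized_fun s w @[s --> t^'+] --> randomized_fun t w;
  randomized_end : forall w, randomized_fun T w = 1 }.

(* [g] is a version of the Radon-Nikodym derivative of
   [A |-> delta (A `*` `[0, t])] with respect to [P]. *)
Record distribution_stopping_time (F : filtration) :=
  DistributionStoppingTime {
  distribution_prob :> probability (Omega * R)%type R;
  distribution_support : distribution_prob (setT `*` `[0, T]) = 1%E;
  distribution_marginal : forall A : set Omega, measurable A ->
    distribution_prob (A `*` setT) = P A;
  distribution_density : forall t, 0 <= t <= T ->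
    exists g : Omega -> R,
      [/\ forall B, measurable B -> completion (F t) P (g @^-1` B),
          P.-integrable setT (EFin \o g) &
          forall A, measurable A ->
            distribution_prob (A `*` `[0, t]) = (\int[P]_(w in A) (g w)%:E)%E] }.

Section randomized_law.
Context {F : filtration}.
Variable rho : randomized_stopping_time F.

(* The jump of size [rho 0 w] at 0 becomes the atom of the law at 0. *)
Definition randomized_cdf (w : Omega) (t : R) : R :=
  if t < 0 then 0 else if t < T then rho t w else 1.

Let cdf_nd w : nondecreasing (randomized_cdf w).
Proof.
move=> s t st; rewrite /randomized_cdf.
case: (ltP s 0) => s0; case: (ltP t 0) => t0 //.
- case: (ltP t T) => // tT; have : 0 <= t <= T by rewrite t0 ltW.
  by move=> /(randomized_range rho)-/(_ w)/andP[].
- by have := lt_le_trans (le_lt_trans st t0) s0; rewrite ltxx.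
- case: (ltP s T) => sT; case: (ltP t T) => tT //.
  + by apply: randomized_nondecreasing => //; exact: ltW.
  + have : 0 <= s <= T by rewrite s0 ltW.
    by move=> /(randomized_range rho)-/(_ w)/andP[].
  + by have := lt_le_trans (le_lt_trans st tT) sT; rewrite ltxx.
Qed.

Let cdf_rc w : right_continuous (randomized_cdf w).
Proof.
move=> t; rewrite {2}/randomized_cdf; case: ltP => t0.
  apply: cvg_near_cst; near=> s; rewrite /randomized_cdf.
  suff -> : s < 0 by [].
  by near: s; exact: nbhs_right_lt.
case: ltP => tT.
  have t0T : 0 <= t < T by rewrite t0.
  apply: (cvg_trans _ (@randomized_right_continuous _ rho w t t0T)).
  apply: near_eq_cvg; near=> s; rewrite /randomized_cdf.
  have ts : t < s by [].
  rewrite ltNge (le_trans t0 (ltW ts))/=.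
  suff -> : s < T by [].
  by near: s; exact: nbhs_right_lt.
apply: cvg_near_cst; near=> s; rewrite /randomized_cdf.
have ts : t < s by [].
by rewrite !ltNge (le_trans t0 (ltW ts)) (le_trans tT (ltW ts)).
Unshelve. all: by end_near. Qed.

HB.instance Definition _ w :=
  isCumulative.Build R _ R (randomized_cdf w) (cdf_nd w) (@cdf_rc w).

Let cdf_Ny w : randomized_cdf w @ -oo --> (0 : R).
Proof.
apply: cvg_near_cst; near=> s; rewrite /randomized_cdf.
suff -> : s < 0 by [].
by near: s; apply: nbhs_ninfty_lt; rewrite num_real.
Unshelve. all: by end_near. Qed.

Let cdf_y w : randomized_cdf w @ +oo --> (1 : R).
Proof.
apply: cvg_near_cst; near=> s; rewrite /randomized_cdf.
have -> : (s < 0) = false.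
  by apply/negbTE; rewrite -leNgt; near: s; apply: nbhs_pinfty_ge; rewrite num_real.
suff -> : (s < T) = false by [].
by apply/negbTE; rewrite -leNgt; near: s; apply: nbhs_pinfty_ge; rewrite num_real.
Unshelve. all: by end_near. Qed.

HB.instance Definition _ w :=
  isCumulativeBounded.Build R 0 1 (randomized_cdf w) (@cdf_Ny w) (@cdf_y w).

Definition randomized_law (w : Omega) : set R -> \bar R :=
  lebesgue_stieltjes_measure (randomized_cdf w).

Let law w : probability (measurableTypeR R) R :=
  lebesgue_stieltjes_measure (randomized_cdf w).

HB.instance Definition _ w := isMeasure.Build _ R R (randomized_law w)
  (@measure0 _ _ _ (law w)) (@measure_ge0 _ _ _ (law w))
  (@measure_semi_sigma_additive _ _ _ (law w)).

HB.instance Definition _ w := @Measure_isProbability.Build _ _ R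
  (randomized_law w) (@probability_setT _ _ _ (law w)).

End randomized_law.

End stopping_times.
Arguments filtration {d} Omega {R} T.
Arguments completed_PxLebesgue {d Omega R} P.

Section distributions.
Context {d : measure_display} {Omega : measurableType d} {R : realType}.
Context {P : probability Omega R} {T : R} {F : filtration Omega T}.

Local Notation PL := (PxLebesgue P).
Local Notation cPL := (completed_PxLebesgue P).

Let sigma_F t : 0 <= t <= T -> <<s F t >> = F t.
Proof. by move=> tT; exact/sigma_algebra_id/filtration_sigma. Qed.

Let prod_borel_measurable t : 0 <= t <= T ->
  prod_borel R (F t) `<=` @measurable _ (Omega * R)%type.
Proof.
move=> tT; apply: smallest_sub; first exact: sigma_algebra_measurable.
move=> _ [A FA [B mB <-]]; apply: measurableX => //.
exact: (filtration_sub tT FA).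
Qed.

Let prod_borel_generated t : 0 <= t <= T ->
  @measurable _ (g_sigma_algebraType (F t) * R)%type = prod_borel R (F t).
Proof.
move=> tT; rewrite measurable_prod_measurableType /prod_borel.
by rewrite -[in RHS](sigma_F tT).
Qed.

Let cPLE (A : set (Omega * R)) : measurable A -> cPL A = PL A.
Proof.
move=> mA; rewrite /completed_PxLebesgue /completed_measure_extension.
by rewrite measurable_mu_extE.
Qed.

Let cPL_measurable (A : set (Omega * R)) : measurable A ->
  @measurable _ (completed_space P) A.
Proof. exact: caratheodory_measurable_mu_ext. Qed.

Let cPL_negligible (N Z : set (Omega * R)) :
  measurable Z -> PL Z = 0%E -> N `<=` Z -> @measurable _ (completed_space P) N.
Proof.
move=> mZ Z0 NZ; apply: (@measure_is_complete_caratheodory _ _ (PL^*)%mu).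
by exists Z; split => //; [exact: cPL_measurable|rewrite -[RHS]Z0 -cPLE].
Qed.

Let outI : PL (setT `*` ~` `[0, 1]) = 0%E.
Proof.
rewrite /PxLebesgue product_measure1E//; last exact: measurableC.
rewrite [X in (_ * X)%E](_ : _ = 0%E) ?mule0//.
by rewrite /= /lebesgue01 /mrestr setICl measure0.
Qed.

Let measurable_out : measurable (setT `*` ~` `[0, 1] : set (Omega * R)).
Proof. by apply: measurableX => //; exact: measurableC. Qed.

Let nullU (Z : set (Omega * R)) : measurable Z -> PL Z = 0%E ->
  PL (Z `|` setT `*` ~` `[0, 1]) = 0%E.
Proof.
move=> mZ Z0; apply: measure_negligible; first exact: measurableU.
by apply: negligibleU; apply/negligibleP.
Qed.

Let sectionmixed (mu : mixed_stopping_time P F) t : 0 <= t <= T ->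
  exists B Z, [/\ prod_borel R (F t) B, measurable Z, PL Z = 0%E,
    [set p | mu p <= t] `<=` B `|` Z & B `<=` [set p | mu p <= t] `|` Z].
Proof.
move=> tT; have [B mB [N [Z [mZ Z0 NZ]] BN]] := mixed_measurable mu tT.
have sE : prod_borel R (F t) = (prod_borel R (F t)).-sigma.-measurable.
  apply/esym/measurable_g_measurableTypeE.
  exact: smallest_sigma_algebra.
have mZ' : measurable (Z : set (Omega * R)) by apply: (prod_borel_measurable tT); rewrite sE.
exists B, (Z `|` setT `*` ~` `[0, 1]); split.
- by rewrite sE.
- exact: measurableU.
- exact: nullU.
- move=> p /= pt; case: (boolP (0 <= p.2 <= 1)) => p01.
    have : (B `|` N) p by rewrite BN.
    by move=> [Bp|/NZ Zp]; [left|right; left].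
  by right; right; split => //=; rewrite in_itv/=; exact/negP.
- move=> p Bp; have : (B `|` N) p by left.
  by rewrite BN => -[]; left.
Qed.

Let cPL_eq (A B Z : set (Omega * R)) : measurable B -> measurable Z ->
  PL Z = 0%E -> A `<=` B `|` Z -> B `<=` A `|` Z -> cPL A = PL B.
Proof.
move=> mB mZ Z0 AB BA.
have c0 : cPL Z = 0%E by rewrite cPLE.
rewrite -cPLE//; apply/eqP; rewrite eq_le; apply/andP; split.
  apply: le_trans (le_outer_measure (PL^*)%mu _ _ AB) _.
  apply: le_trans (outer_measureU2 (PL^*)%mu _ _) _.
  by rewrite [X in (_ + X)%E]c0 adde0.
apply: le_trans (le_outer_measure (PL^*)%mu _ _ BA) _.
apply: le_trans (outer_measureU2 (PL^*)%mu _ _) _.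
by rewrite [X in (_ + X)%E]c0 adde0.
Qed.

(* Values of [mu] outside [Omega * `[0, 1]] matter only on a null set. *)
Definition mixed_graph (mu : mixed_stopping_time P F) :
  completed_space P -> Omega * R := fun p => (p.1, mu p).

Let mixed_graph_measurable mu : measurable_fun setT (mixed_graph mu).
Proof.
apply: measurable_fun_pair.
  move=> _ A mA; rewrite setTI; apply: cPL_measurable.
  by rewrite -[X in measurable X]setTI; exact: measurable_fst.
have mle t : 0 <= t <= T -> @measurable _ (completed_space P) [set p | mu p <= t].
  move=> tT; have [B [Z [mB mZ Z0 h1 h2]]] := sectionmixed mu tT.
  have -> : [set p | mu p <= t] = (B `\` Z) `|` ([set p | mu p <= t] `&` Z).
    apply/seteqP; split=> p; last by move=> [[/h2[]]|[]].
    move=> /[dup] pt /h1; have [Zp|Zp] := pselect (Z p); first by right.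
    by case=> // Bp; left.
  apply: measurableU; last by apply: cPL_negligible Z0 _ => // p [].
  apply: cPL_measurable; apply: measurableD => //.
  exact: (prod_borel_measurable tT).
apply: (measurability _ (RGenOInfty.measurableE R)) => _ [_ [t ->] <-].
rewrite setTI; have -> : (fun p => mu p) @^-1` `]t, +oo[ = ~` [set p | mu p <= t].
  by apply/seteqP; split => p /=; rewrite in_itv/= andbT ltNge => /negP.
apply: measurableC.
case: (ltP t 0) => t0.
  apply: (cPL_negligible _ outI); first exact: measurable_out.
  move=> [w r]/= rt; split => //=; rewrite in_itv/= => /(mixed_range mu w)/andP[m0 _].
  by have := lt_le_trans (le_lt_trans rt t0) m0; rewrite ltxx.
case: (leP t T) => tT; first by apply: mle; rewrite t0.
rewrite -(setCK [set p | _]); apply: measurableC.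
apply: (cPL_negligible _ outI); first exact: measurable_out.
move=> [w r]/= rt; split => //=; rewrite in_itv/= => /(mixed_range mu w)/andP[_ mT].
by apply: rt; exact: le_trans (ltW tT).
Qed.

HB.instance Definition _ mu := isMeasurableFun.Build _ _ _ _
  (mixed_graph mu) (mixed_graph_measurable mu).

Let dm (mu : mixed_stopping_time P F) := distribution cPL (mixed_graph mu).

Let dm_support mu : dm mu (setT `*` `[0, T]) = 1%E.
Proof.
rewrite /dm /distribution /pushforward.
rewrite -[RHS](@probability_setT _ _ _ (P \x lebesgue01)%E).
apply: (@cPL_eq _ setT (setT `*` ~` `[0, 1])) => //.
- by move=> p _; left.
- move=> [w r] _; have [r01|r01] := pselect (0 <= r <= 1).
    by left; split => //=; rewrite in_itv/=; exact: mixed_range.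
  by right; split => //=; rewrite in_itv.
Qed.

Let dm_marginal mu (A : set Omega) : measurable A -> dm mu (A `*` setT) = P A.
Proof.
move=> mA; rewrite /dm /distribution /pushforward.
have h : cPL (A `*` [set: R]) = PL (A `*` [set: R]).
  by apply: cPLE; apply: measurableX.
rewrite [LHS]h /PxLebesgue product_measure1E//.
rewrite [X in (_ * X)%E](_ : _ = 1%E) ?mule1//.
exact: (@probability_setT _ _ _ (@lebesgue01 R)).
Qed.

Let completionW t (A : set Omega) : 0 <= t <= T -> F t A -> completion (F t) P A.
Proof.
move=> tT FA; exists A; first by rewrite /measurable/= sigma_F.
exists set0; last by rewrite setU0.
exists set0; split => //; exact: measure0.
Qed.

Let dm_density mu t : 0 <= t <= T ->
    exists g : Omega -> R,
      [/\ forall B, measurable B -> completion (F t) P (g @^-1` B),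
          P.-integrable setT (EFin \o g) &
          forall A, measurable A ->
            dm mu (A `*` `[0, t]) = (\int[P]_(w in A) (g w)%:E)%E].
Proof.
move=> tT; have [B [Z [pB mZ Z0 h1 h2]]] := sectionmixed mu tT.
have mB := prod_borel_measurable tT pB.
have fin w : lebesgue01 (xsection B w) \is a fin_num.
  by apply: fin_num_measure; exact: measurable_xsection.
pose g w := fine (lebesgue01 (xsection B w)).
have gE w : (g w)%:E = lebesgue01 (xsection B w) by rewrite /g fineK.
have mgF : forall S, measurable S -> F t (g @^-1` S).
  have mB' : @measurable _ (g_sigma_algebraType (F t) * R)%type B.
    by rewrite prod_borel_generated.
  have := @measurable_fun_xsection _ _ (g_sigma_algebraType (F t)) R R
    lebesgue01 _ mB'.
  move=> h S mS.
  have : measurable_fun [set: g_sigma_algebraType (F t)] g.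
    by apply/measurable_EFinP; apply: eq_measurable_fun h => w _ /=; rewrite gE.
  move=> /(_ measurableT S mS); rewrite setTI.
  by rewrite /measurable/= sigma_F.
have mg : measurable_fun [set: Omega] g.
  by move=> _ S mS; rewrite setTI; apply: (filtration_sub tT); exact: mgF.
exists g; split => [S mS||A mA].
- exact/completionW/mgF.
- apply: (@le_integrable _ _ _ P _ measurableT _ (cst 1%E)).
  + exact/measurable_EFinP.
  + move=> w _; rewrite /= lee_fin normr1 ger0_norm ?fine_ge0//.
    rewrite -lee_fin gE.
    by apply: (@probability_le1 _ _ _ (@lebesgue01 R)); exact: measurable_xsection.
  + exact: finite_measure_integrable_cst.
rewrite /dm /distribution /pushforward.
transitivity (PL ((A `*` setT) `&` B)); last first.
  rewrite /PxLebesgue /product_measure1 [RHS]integral_mkcond.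
  apply: eq_integral => w _; rewrite /= patchE.
  case: ifPn => wA.
    rewrite gE; congr lebesgue01; apply/seteqP; split => r; rewrite /xsection/= !inE.
      by case.
    by move=> Br; split => //; split => //; exact: set_mem.
  suff -> : xsection ((A `*` setT) `&` B) w = set0 by rewrite measure0.
  rewrite -subset0 => r; rewrite /xsection/= inE => -[[/= Aw _] _].
  by move/negP : wA; apply; exact: mem_set.
apply: (@cPL_eq _ _ (Z `|` (setT `*` ~` `[0, 1]))).
- by apply: measurableI => //; exact: measurableX.
- exact: measurableU.
- exact: nullU.
- move=> p [/= Ap]; rewrite in_itv/= => /andP[_ pt].
  by have [Bp|Zp] := h1 p pt; [left|right; left].
- move=> [w r] [[/= Ap _] Bp]; have [r01|r01] := pselect (0 <= r <= 1).
    have [pt|Zp] := h2 _ Bp; last by right; left.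
    left; split => //=; rewrite in_itv/=; apply/andP; split => //.
    by have /andP[] := mixed_range mu w r01.
  by right; right; split => //=; rewrite in_itv.
Qed.

(* The push-forward of the completed product measure along the graph. *)
Definition delta_mixed (mu : mixed_stopping_time P F) :
    distribution_stopping_time P F :=
  @DistributionStoppingTime _ _ _ _ _ _
    (distribution cPL (mixed_graph mu))
    (dm_support mu) (@dm_marginal mu) (@dm_density mu).

End distributions.

Section randomized_distribution.
Context {d : measure_display} {Omega : measurableType d} {R : realType}.
Context {P : probability Omega R} {T : R} {F : filtration Omega T}.
Variables (T_gt0 : 0 < T) (F_usual : usual_conditions P F).
Variable rho : randomized_stopping_time P F.

Let rho_measurable t : 0 <= t <= T -> measurable_fun setT (rho t).
Proof.
move=> tT _ B mB; rewrite setTI.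
have [A mA [N [Z [mZ Z0 NZ]] <-]] := randomized_adapted rho tT mB.
have FE : <<s F t >> = F t by exact/sigma_algebra_id/filtration_sigma.
have mF : <<s F t >> `<=` @measurable _ Omega by rewrite FE; exact: filtration_sub.
apply: measurableU; first exact: mF.
have [_ + _] := F_usual; move=> nF.
apply: (@filtration_sub _ _ _ _ F 0); first by rewrite lexx ltW.
by apply: nF; exists Z; split => //; exact: mF.
Qed.

Let cdf_measurable t : measurable_fun setT (fun w => randomized_cdf rho w t).
Proof.
rewrite /randomized_cdf; case: ltP => t0; first exact: measurable_cst.
case: ltP => tT; last exact: measurable_cst.
by apply: rho_measurable; rewrite t0 ltW.
Qed.

Let law_oc w (a b : R) : a <= b -> randomized_law rho w `]a, b] =
  (randomized_cdf rho w b - randomized_cdf rho w a)%:E.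
Proof.
move=> ab; rewrite /randomized_law /lebesgue_stieltjes_measure /measure_extension/=.
by rewrite measurable_mu_extE/= ?wlength_itv_bnd//; exact: is_ocitv.
Qed.

Let law_measurable (U : set R) : measurable U ->
  measurable_fun setT (randomized_law rho ^~ U).
Proof.
move: U; apply: (@dynkin_induction _ R (@ocitv R)
  (fun U => measurable_fun setT (randomized_law rho ^~ U))) => //.
- exact: ocitvI.
- under eq_fun do rewrite probability_setT.
  exact: measurable_cst.
- move=> _ [[a b] _ <-]/=; case: (leP a b) => ab.
    under eq_fun do rewrite law_oc//.
    by apply/measurable_EFinP; apply: measurable_funB; exact: cdf_measurable.
  rewrite set_itv_ge; last by rewrite bnd_simp -leNgt ltW.
  under eq_fun do rewrite measure0.
  exact: measurable_cst.
- move=> S mS hS; under eq_fun do rewrite probability_setC//.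
  by apply: emeasurable_funB => //; exact: measurable_cst.
- move=> A mA tA hA.
  rewrite (_ : (fun w => _) = (fun w => \sum_(k <oo) randomized_law rho w (A k))%E).
    by apply: ge0_emeasurable_sum => // k w _ _; exact: measure_ge0.
  apply/funext => w; rewrite measure_bigcup//.
  by apply: eq_eseriesl => k; rewrite in_setT.
Qed.

Definition randomized_kernel : Omega -> {measure set R -> \bar R} := randomized_law rho.

HB.instance Definition _ := @isKernel.Build _ _ Omega R R randomized_kernel law_measurable.
HB.instance Definition _ := @Kernel_isProbability.Build _ _ Omega R R randomized_kernel
  (fun w => @probability_setT _ _ _ (randomized_law rho w)).

Definition randomized_product (C : set (Omega * R)) : \bar R :=
  (\int[P]_w randomized_law rho w (xsection C w))%E.

Let dr0 : randomized_product set0 = 0%E.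
Proof. by rewrite /randomized_product integral0_eq// => w _; rewrite xsection0 measure0. Qed.

Let dr_ge0 C : (0 <= randomized_product C)%E.
Proof. by apply: integral_ge0 => w _; exact: measure_ge0. Qed.

Let dr_sigma : semi_sigma_additive randomized_product.
Proof.
move=> A mA tA mUA.
rewrite [X in _ --> X](_ : _ = \sum_(n <oo) randomized_product (A n))%E.
  apply/cvg_closeP; split; last by rewrite closeE.
  by apply: is_cvg_nneseries => n _ _; exact: dr_ge0.
rewrite -integral_nneseries//; last first.
  by move=> n; apply: (@measurable_fun_xsection_finite_kernel _ _ _ _ R randomized_kernel); rewrite inE.
apply: eq_integral => w _; apply/esym/cvg_lim => //=; rewrite xsection_bigcup.
apply: (measure_sigma_additive _ (trivIset_xsection tA)) => n.
exact: measurable_xsection.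
Qed.

HB.instance Definition _ := isMeasure.Build _ _ _ randomized_product dr0 dr_ge0 dr_sigma.

Let drX A B : measurable A -> measurable B ->
  randomized_product (A `*` B) = (\int[P]_(w in A) randomized_law rho w B)%E.
Proof.
move=> mA mB; rewrite /randomized_product [RHS]integral_mkcond; apply: eq_integral => w _.
rewrite patchE; case: ifPn => wA; first by rewrite in_xsectionX.
by rewrite notin_xsectionX// measure0.
Qed.

Let law_setT w : randomized_law rho w [set: R] = 1%E.
Proof. exact: probability_setT. Qed.

Let dr_setT : randomized_product setT = 1%E.
Proof.
rewrite -setXTT drX//; under eq_integral do rewrite law_setT.
by rewrite integral_cst// mul1e; exact: (@probability_setT _ _ _ P).
Qed.

HB.instance Definition _ := @Measure_isProbability.Build _ _ R randomized_product dr_setT.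

Let law_0t w t : 0 <= t <= T -> randomized_law rho w `[0, t] = (rho t w)%:E.
Proof.
move=> /andP[t0 tT].
have cdfN x : x < 0 -> randomized_cdf rho w x = 0 by rewrite /randomized_cdf => ->.
have cdft : randomized_cdf rho w t = rho t w.
  rewrite /randomized_cdf ltNge t0/=; case: ltP => // Tt.
  have -> : t = T by apply/eqP; rewrite eq_le tT.
  by rewrite randomized_end.
have N0 : randomized_law rho w `]-1, 0[ = 0%E.
  apply: measure_negligible => //; rewrite itv_bnd_open_bigcup.
  apply: negligible_bigcup => n; apply/negligibleP => //.
  have n1 : - 1 <= 0 - n.+1%:R^-1 :> R.
    by rewrite sub0r lerN2 invf_le1 ?ler1n.
  by rewrite [LHS](law_oc w n1) !cdfN ?subrr ?ltrN10//.
have -> : `[0, t]%classic = `]-1, t] `\` `]-1, 0[.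
  apply/seteqP; split=> x /=; rewrite !in_itv/=.
    move=> /andP[x0 xt]; split; first by rewrite (lt_le_trans _ x0)// ltrN10.
    by move=> /andP[_]; rewrite ltNge x0.
  move=> [/andP[x1 xt]] /negP; rewrite x1/= -leNgt => x0.
  by rewrite x0.
have tN : - 1 <= t by rewrite (le_trans _ t0)// lerN10.
rewrite measureD//=.
- rewrite setIidr; last by apply: subset_itvl; rewrite bnd_simp.
  by rewrite N0 sube0 law_oc// (cdfN (-1)) ?ltrN10// subr0 cdft.
- by rewrite law_oc// ltry.
Qed.

Lemma delta_randomized_exists :
  exists delta : distribution_stopping_time P F,
    forall t A, 0 <= t <= T -> measurable A ->
      delta (A `*` `[0, t]) = (\int[P]_(w in A) (rho t w)%:E)%E.
Proof.
have spec t A : 0 <= t <= T -> measurable A ->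
    randomized_product (A `*` `[0, t]) = (\int[P]_(w in A) (rho t w)%:E)%E.
  by move=> tT mA; rewrite drX//; apply: eq_integral => w _; rewrite law_0t.
have sup : randomized_product (setT `*` `[0, T]) = 1%E.
  rewrite spec//; last by rewrite lexx ltW.
  under eq_integral do rewrite randomized_end.
  by rewrite integral_cst// mul1e; exact: (@probability_setT _ _ _ P).
have marg (A : set Omega) : measurable A -> randomized_product (A `*` setT) = P A.
  move=> mA; rewrite drX//; under eq_integral do rewrite law_setT.
  by rewrite integral_cst// mul1e.
have dens t : 0 <= t <= T -> exists g : Omega -> R,
    [/\ forall B, measurable B -> completion (F t) P (g @^-1` B),
        P.-integrable setT (EFin \o g) &
        forall A, measurable A ->
          randomized_product (A `*` `[0, t]) = (\int[P]_(w in A) (g w)%:E)%E].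
  move=> tT; exists (rho t); split; last by move=> A mA; exact: spec.
    exact: randomized_adapted.
  apply: (@le_integrable _ _ _ P _ measurableT _ (cst 1%E)).
  - exact/measurable_EFinP/rho_measurable.
  - move=> w _; have /andP[r0 r1] := randomized_range rho w tT.
    by rewrite /= lee_fin normr1 ger0_norm.
  - exact: finite_measure_integrable_cst.
by exists (@DistributionStoppingTime _ _ _ _ _ _ randomized_product sup marg dens).
Qed.

(* The defining identities determine the measure on all measurable sets, so
   the choice made by [cid] is immaterial. *)
Definition delta_randomized : distribution_stopping_time P F :=
  sval (cid delta_randomized_exists).

Lemma delta_randomizedE t A : 0 <= t <= T -> measurable A ->
  delta_randomized (A `*` `[0, t]) = (\int[P]_(w in A) (rho t w)%:E)%E.
Proof. exact: (svalP (cid delta_randomized_exists)). Qed.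

End randomized_distribution.

Record stopping_problem (d : measure_display) (Omega : measurableType d)
    (R : realType) (T : R) := StoppingProblem {
  problem_fun :> R -> Omega -> R;
  problem_bounded : exists M : R,
    forall t w, 0 <= t <= T -> `|problem_fun t w| <= M;
  problem_measurable :
    measurable_fun (setT `*` `[0, T] : set (Omega * R))
      (fun p => problem_fun p.2 p.1) }.
Arguments stopping_problem {d} Omega {R} T.

Section payoffs.
Context {d : measure_display} {Omega : measurableType d} {R : realType}.
Context {P : probability Omega R} {T : R} {F : filtration Omega T}.
Local Open Scope ereal_scope.

Definition payoff_mixed (X : stopping_problem Omega T)
    (mu : mixed_stopping_time P F) : \bar R :=
  \int[completed_PxLebesgue P]_(p in setT `*` `[0%R, 1%R]) (X (mu p) p.1)%:E.

Definition payoff_randomized (X : stopping_problem Omega T)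
    (rho : randomized_stopping_time P F) : \bar R :=
  \int[P]_w \int[randomized_law rho w]_(t in `[0%R, T]) (X t w)%:E.

Definition payoff_distribution (X : stopping_problem Omega T)
    (delta : distribution_stopping_time P F) : \bar R :=
  \int[delta]_(p in setT `*` `[0%R, T]) (X p.2 p.1)%:E.

(* Library measures are functions on all sets; equality of measures means
   equality on measurable sets. *)
Definition equivalent (T_gt0 : (0 < T)%R) (F_usual : usual_conditions P F)
    (mu : mixed_stopping_time P F) (rho : randomized_stopping_time P F) : Prop :=
  forall C, measurable C ->
    delta_mixed mu C = delta_randomized T_gt0 F_usual rho C.

End payoffs.

(* Main.v *)
Require Import Defs.
From HB Require Import structures.
From mathcomp Require Import all_boot all_order all_algebra.
From mathcomp Require Import all_classical all_reals all_analysis.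
From mathcomp Require Import measurable_realfun.

(** Every payoff is the integral of one bounded measurable function on
    [Omega * R], the payoff [(w, t) |-> X t w] extended by zero outside
    [[0, T]], against the distribution stopping time.

    For a mixed stopping time [mu], the law [delta_mixed mu] is by definition
    the image of [P \x lebesgue01] under the graph [(w, r) |-> (w, mu (w, r))],
    so the claim is the change of variables formula [integral_distribution].
    Two points need care: the graph is only measurable for the completed
    product measure, and values of [mu] at [r] outside [[0, 1]] are arbitrary,
    but such [(w, r)] form a null set ([completed_null_outside]).

    For a randomized stopping time [rho], the identities that characterise
    [delta_randomized] on the rectangles [A `*` [0, t]] say that it agrees
    there with the measure [C |-> \int[P]_w (law of rho w) (C_w)], where [C_w]
    is the section of [C] at [w].  Both measures vanish outside [[0, T]], so the
    agreement extends to all rectangles [A `*` ]-oo, t]], which generate the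
    product sigma-algebra and are stable under intersection
    ([eq_measure_lower_rays]); hence the two measures coincide
    ([delta_randomized_disintegration]).  A Fubini theorem for measures
    disintegrated along a kernel ([integral_disintegration]) then turns the
    integral against [delta_randomized] into the iterated integral that defines
    the payoff of [rho].

    Equivalent stopping times induce the same distribution, so the equality of
    their payoffs follows from the two other statements. *)

Set Implicit Arguments.
Unset Strict Implicit.
Unset Printing Implicit Defensive.

Import Order.TTheory GRing.Theory Num.Theory.

Local Open Scope classical_set_scope.
Local Open Scope ring_scope.

(** * Integration against a measure disintegrated along a kernel *)

Section disintegration.
Context d d' (X : measurableType d) (Y : measurableType d') (R : realType).
Variables (P : {measure set X -> \bar R}) (k : R.-fker X ~> Y).
Variable m : {measure set (X * Y) -> \bar R}.
Hypothesis mE : forall C, measurable C ->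
  m C = (\int[P]_x k x (xsection C x))%E.
Local Open Scope ereal_scope.

Import HBNNSimple.

Let integral_slice_indic (A : set (X * Y)) x : measurable A ->
  \int[k x]_y (\1_A (x, y))%:E = k x (xsection A x).
Proof. by move=> mA; exact: (congr1 (@^~ x) (kfcompkindic k mA)). Qed.

Let measurable_slice (f : X * Y -> R) x :
  measurable_fun setT f -> measurable_fun setT (fun y => (f (x, y))%:E).
Proof. by move=> mf; exact/measurable_EFinP/measurableT_comp. Qed.

Let integral_slice_nnsfun (f : {nnsfun (X * Y) >-> R}) x :
  \int[k x]_y (f (x, y))%:E =
  \sum_(r \in range f) r%:E * k x (xsection (f @^-1` [set r]) x).
Proof.
under eq_integral do rewrite fimfunE -fsumEFin//.
rewrite ge0_integral_fsum//; last 2 first.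
- move=> r; apply: (measurable_slice (f := fun z => (r * \1_(f @^-1` [set r]) z)%R)).
  exact: measurable_funM.
- by move=> r y _; rewrite nnfun_muleindic_ge0.
apply: eq_fsbigr => r _; under eq_integral do rewrite EFinM.
have mfr : measurable (f @^-1` [set r]) by exact: measurable_sfunP.
have [r0|r0] := leP 0%R r.
  by rewrite ge0_integralZl ?integral_slice_indic//; exact: measurable_slice.
(* a negative number is not a value of [f], so both sides vanish *)
rewrite preimage_nnfun0// xsection0 measure0 mule0.
by rewrite integral0_eq// => y _; rewrite indic0 mule0.
Qed.

Let integral_disintegration_nnsfun (f : {nnsfun (X * Y) >-> R}) :
  \int[m]_z (f z)%:E = \int[P]_x \int[k x]_y (f (x, y))%:E.
Proof.
under [RHS]eq_integral do rewrite integral_slice_nnsfun.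
have mfr r : measurable (f @^-1` [set r]) by exact: measurable_sfunP.
have mk r : measurable_fun setT (fun x => k x (xsection (f @^-1` [set r]) x)).
  by apply: measurable_fun_xsection_finite_kernel; rewrite inE.
rewrite ge0_integral_fsum//; last 2 first.
- by move=> r; exact: measurable_funeM.
- move=> r x _; have [r0|r0] := leP 0%R r; first exact: mule_ge0.
  by rewrite preimage_nnfun0// xsection0 measure0 mule0.
rewrite integralT_nnsfun sintegralE; apply: eq_fsbigr => r _.
rewrite mE//; have [r0|r0] := leP 0%R r; first by rewrite ge0_integralZl.
rewrite !preimage_nnfun0// integral0_eq ?integral0_eq ?mule0// => x _.
  by rewrite xsection0 measure0 mule0.
by rewrite xsection0 measure0.
Qed.

(** Increasing approximation by simple functions, with monotone convergence
    applied in the inner and then in the outer integral. *)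
Lemma ge0_integral_disintegration (f : X * Y -> \bar R) :
  (forall z, 0 <= f z) -> measurable_fun setT f ->
  \int[m]_z f z = \int[P]_x \int[k x]_y f (x, y).
Proof.
move=> f0 mf; pose f_ := nnsfun_approx measurableT mf.
have f_cvg z : limn (fun n => (f_ n z)%:E) = f z.
  by apply/cvg_lim => //=; exact: cvg_nnsfun_approx.
have f_ge0 n z : 0 <= (f_ n z)%:E by rewrite lee_fin.
have f_nd z : {homo (fun n => (f_ n z)%:E) : a b / (a <= b)%N >-> a <= b}.
  by move=> a b ab; rewrite lee_fin; exact/lefP/nd_nnsfun_approx.
have mf_ n : measurable_fun setT (fun z => (f_ n z)%:E) by exact/measurable_EFinP.
have mf_x n x : measurable_fun setT (fun y => (f_ n (x, y))%:E).
  exact: measurable_slice.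
rewrite -[f in LHS](funext f_cvg) monotone_convergence//.
under [in LHS]eq_fun do rewrite integral_disintegration_nnsfun.
rewrite -monotone_convergence//.
- apply: eq_integral => x _; rewrite -monotone_convergence//.
  by apply: eq_integral => y _; rewrite f_cvg.
- move=> n; exact: (measurable_fun_integral_finite_kernel
    (fun z => (f_ n z)%:E) k).
- by move=> n x _; exact: integral_ge0.
- by move=> x _ a b ab; apply: ge0_le_integral => // y _; exact: f_nd.
Qed.

(** The inner integrals of the positive and the negative parts are themselves
    integrable, by the nonnegative case, and can therefore be subtracted. *)
Lemma integral_disintegration (f : X * Y -> \bar R) :
  m.-integrable setT f -> \int[m]_z f z = \int[P]_x \int[k x]_y f (x, y).
Proof.
move=> intf.
have inner (g : X * Y -> \bar R) : (forall z, 0 <= g z) ->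
    m.-integrable setT g -> P.-integrable setT (fun x => \int[k x]_y g (x, y)).
  move=> g0 /integrableP[mg goo]; apply/integrableP; split.
    exact: (measurable_fun_integral_finite_kernel g k).
  under eq_integral do rewrite gee0_abs ?integral_ge0//.
  rewrite -ge0_integral_disintegration//.
  by under eq_integral do rewrite -[g _]gee0_abs//.
have intp := integrable_funepos measurableT intf.
have intn := integrable_funeneg measurableT intf.
rewrite [LHS]integralE !ge0_integral_disintegration//; last 2 first.
- exact: (measurable_int m intn).
- exact: (measurable_int m intp).
rewrite -integralB//; [|exact: inner..].
apply: eq_integral => x _; rewrite [RHS](integralE (k x) setT (f \o pair x)).
by rewrite (funepos_comp f (pair x)) (funeneg_comp f (pair x)).
Qed.

End disintegration.

(** * Measures determined by half-lines in the real coordinate *)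

(** Dynkin's argument, used first in the second coordinate with [A] fixed, where
    half-lines generate the Borel sets, and then on rectangles.  Equality on
    [A `*` setT] serves to pass to complements in the second coordinate, and so
    from the rays [`]-oo, t]], natural for distribution functions, to the
    generating rays [`]t, +oo[]. *)
Lemma eq_measure_lower_rays d (X : measurableType d) (R : realType)
    (m1 m2 : {finite_measure set (X * R)%type -> \bar R}) :
  (forall A, measurable A -> m1 (A `*` setT) = m2 (A `*` setT)) ->
  (forall A t, measurable A -> m1 (A `*` `]-oo, t]) = m2 (A `*` `]-oo, t])) ->
  forall C, measurable C -> m1 C = m2 C.
Proof.
move=> m12T m12ray.
have diff (m : {finite_measure set (X * R)%type -> \bar R}) (A : set X) (B : set R) :
    measurable A -> measurable B ->
    m (A `*` ~` B) = (m (A `*` setT) - m (A `*` B))%E.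
  move=> mA mB.
  have -> : A `*` ~` B = (A `*` setT) `\` (A `*` B).
    apply/seteqP; split=> p /=; first by move=> [Ap nB]; split => // -[].
    by move=> [[Ap _] nAB]; split => // Bp; apply: nAB.
  have mAB : measurable (A `*` B) by exact: measurableX.
  have mAT : measurable (A `*` [set: R]) by exact: measurableX.
  rewrite measureD//; last by rewrite ltey_eq fin_num_measure.
  by congr (_ - m _)%E; rewrite setIidr// => p [].
have m12rect (A : set X) (B : set R) :
    measurable A -> measurable B -> m1 (A `*` B) = m2 (A `*` B).
  move=> mA mB; have GE := RGenOInfty.measurableE R.
  have : <<s RGenOInfty.G (R:=R) >> B by rewrite -[<<s _ >>]GE.
  move: B {mB}; apply: (@dynkin_induction _ R _
    (fun B => m1 (A `*` B) = m2 (A `*` B))) => //.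
  - move=> _ _ [x ->] [y ->]; exists (Num.max x y).
    by apply/seteqP; split=> z /=; rewrite !in_itv/= !andbT gt_max => /andP.
  - exact: m12T.
  - by move=> _ [t ->]; rewrite -setCitvl !diff// m12T// m12ray.
  - by move=> B mB m12B; rewrite !diff// m12T// m12B.
  - move=> B mB tB m12B; have mAB n : measurable (A `*` B n) by exact: measurableX.
    have tAB : trivIset setT (fun n => A `*` B n).
      by move=> i j _ _ [[x t] [[_ Bi] [_ Bj]]]; apply: (tB i j) => //; exists t.
    rewrite setX_bigcupr !measure_bigcup//.
    by apply: eq_eseriesr => n _; exact: m12B.
pose rect := [set A `*` B | A in @measurable _ X & B in @measurable _ R].
apply: (measure_unique rect (fun=> setT)).
- exact: measurable_prod_measurableType.
- move=> _ _ [A1 mA1 [B1 mB1 <-]] [A2 mA2 [B2 mB2 <-]].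
  exists (A1 `&` A2); first exact: measurableI.
  by exists (B1 `&` B2); [exact: measurableI|rewrite setXI].
- by move=> _; exists setT => //; exists setT => //; rewrite setXTT.
- by rewrite bigcup_const//; exists 0%N.
- by move=> _ [A mA [B mB <-]]; exact: m12rect.
- by move=> _; rewrite ltey_eq fin_num_measure.
Qed.

(** * Payoffs as integrals of a single function *)

Section payoff_function.
Context {d : measure_display} {Omega : measurableType d} {R : realType} {T : R}.
Variable X : stopping_problem Omega T.

(** Extension by zero makes the payoff measurable and bounded on the whole
    space, so that integrals over [[0, T]] and over the line can be exchanged
    freely. *)
Definition payoff_fun : Omega * R -> \bar R :=
  (fun p => (X p.2 p.1)%:E) \_ (setT `*` `[0, T]).

Lemma payoff_funE w t : 0 <= t <= T -> payoff_fun (w, t) = (X t w)%:E.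
Proof.
by move=> tT; rewrite /payoff_fun patchE mem_set//; split; rewrite //= in_itv.
Qed.

Lemma measurable_payoff_fun : measurable_fun setT payoff_fun.
Proof.
have mD : measurable (setT `*` `[0, T] : set (Omega * R)) by apply: measurableX.
rewrite /payoff_fun; apply/(measurable_restrictT _ mD).
by apply/measurable_EFinP; exact: (problem_measurable X).
Qed.

Lemma payoff_fun_bounded : exists M : R, forall p, (`|payoff_fun p| <= M%:E)%E.
Proof.
have [M XM] := problem_bounded X; exists `|M| => p.
rewrite /payoff_fun patchE; case: ifPn => [/set_mem[_ /=]|_].
  rewrite in_itv/= => pT; rewrite /= lee_fin.
  by rewrite (le_trans (XM _ _ pT))// ler_norm.
by rewrite abse0 lee_fin.
Qed.

Lemma integrable_payoff_fun_comp d' (S : measurableType d')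
    (m : probability S R) (g : S -> Omega * R) :
  measurable_fun setT g -> m.-integrable setT (payoff_fun \o g).
Proof.
move=> mg; have [M XM] := payoff_fun_bounded.
have mpg : measurable_fun setT (payoff_fun \o g).
  exact: measurableT_comp measurable_payoff_fun mg.
apply: (le_integrable measurableT mpg (g := cst M%:E)).
  by move=> s _; rewrite /= (le_trans (XM _))// lee_fin ler_norm.
exact: finite_measure_integrable_cst.
Qed.

End payoff_function.

Lemma payoff_distributionE d (Omega : measurableType d) (R : realType)
    (P : probability Omega R) (T : R) (F : filtration Omega T)
    (X : stopping_problem Omega T) (delta : distribution_stopping_time P F) :
  payoff_distribution X delta = (\int[delta]_p payoff_fun X p)%E.
Proof. by rewrite /payoff_distribution integral_mkcond. Qed.

(** * Mixed stopping times *)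

Section mixed.
Context {d : measure_display} {Omega : measurableType d} {R : realType}.
Context {P : probability Omega R} {T : R} {F : filtration Omega T}.

Local Notation outside := (setT `*` ~` `[0, 1] : set (Omega * R)).

(** The randomisation interval carries all the mass of [lebesgue01]; this is
    why the arbitrary values of a mixed stopping time at [r] outside [[0, 1]] do
    not affect its distribution. *)
Lemma completed_null_outside :
  @measurable _ (completed_space P) outside /\
  completed_PxLebesgue P outside = 0%E.
Proof.
have mO : measurable outside by apply: measurableX => //; exact: measurableC.
have PO : PxLebesgue P outside = 0%E.
  rewrite /PxLebesgue product_measure1E//; last exact: measurableC.
  rewrite [X in (_ * X)%E](_ : _ = 0%E) ?mule0//.
  by rewrite /= /lebesgue01 /mrestr setICl measure0.
split; first exact: caratheodory_measurable_mu_ext.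
rewrite -[RHS]PO /completed_PxLebesgue /completed_measure_extension.
by rewrite measurable_mu_extE.
Qed.

(** Change of variables along the graph of [mu], which is measurable for the
    completed product measure, followed by the removal of the null set of the
    [(w, r)] with [r] outside [[0, 1]]. *)
Lemma payoff_mixed_distribution (X : stopping_problem Omega T)
    (mu : mixed_stopping_time P F) :
  payoff_mixed X mu = payoff_distribution X (delta_mixed mu).
Proof.
have [mO O0] := completed_null_outside.
have intX : (completed_PxLebesgue P).-integrable setT
    (payoff_fun X \o mixed_graph mu).
  by apply: integrable_payoff_fun_comp; exact: measurable_funPT.
rewrite payoff_distributionE integral_distribution//; last first.
  exact: measurable_payoff_fun.
rewrite (negligible_integral mO)//.
have -> : setT `\` outside = setT `*` `[0, 1].
  apply/seteqP; split=> p /=.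
    by move=> [_ /not_andP[|/contrapT]].
  by move=> [_ p01]; split => // -[_].
apply: eq_integral => -[w r] /set_mem[_ /=]; rewrite in_itv/= => r01.
by rewrite payoff_funE//; exact: mixed_range.
Qed.

End mixed.

(** * Randomized stopping times *)

Section randomized.
Context {d : measure_display} {Omega : measurableType d} {R : realType}.
Context {P : probability Omega R} {T : R} {F : filtration Omega T}.
Variables (T_gt0 : 0 < T) (F_usual : usual_conditions P F).
Variable rho : randomized_stopping_time P F.

Local Notation delta := (delta_randomized T_gt0 F_usual rho).

(* The laws of [rho] form a kernel only thanks to [T_gt0] and [F_usual]: [rho t]
   is adapted to a completed sigma-algebra, and it is measurable because the
   usual conditions put all null sets into [F 0]. *)
Let kappa : R.-fker Omega ~> R :=
  Defs_randomized_kernel__canonical__kernel_FiniteKernel T_gt0 F_usual rho.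
Let product : probability (Omega * R)%type R :=
  Defs_randomized_product__canonical__probability_measure_Probability
    T_gt0 F_usual rho.

Let law_itvNyc w t :
  randomized_law rho w `]-oo, t] = (randomized_cdf rho w t)%:E.
Proof. exact: (cdf_lebesgue_stieltjes_id (randomized_cdf rho w)). Qed.

Let delta_outside (A : set (Omega * R)) :
  measurable A -> A `<=` setT `*` ~` `[0, T] -> delta A = 0%E.
Proof.
have mO : measurable (setT `*` ~` `[0, T] : set (Omega * R)).
  by apply: measurableX => //; exact: measurableC.
move=> mA AO; apply: (subset_measure0 mA mO AO).
have -> : setT `*` ~` `[0, T] = ~` (setT `*` `[0, T]) :> set (Omega * R).
  apply/seteqP; split=> p /=; first by move=> [_ pO] [].
  by move=> pO; split => // pT; apply: pO.
have mI : measurable (setT `*` `[0, T] : set (Omega * R)).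
  by apply: measurableX.
rewrite [LHS](probability_setC _ mI).
by rewrite distribution_support subee.
Qed.

(** Up to a null set, [`]-oo, t]] is empty for [t < 0] and is [[0, min t T]]
    otherwise; on the latter interval [delta] is prescribed. *)
Let delta_ray (A : set Omega) (t : R) : measurable A ->
  delta (A `*` `]-oo, t]) = (\int[P]_(w in A) (randomized_cdf rho w t)%:E)%E.
Proof.
move=> mA; rewrite /randomized_cdf.
have mAt : measurable (A `*` `]-oo, t]) by apply: measurableX.
have [t0|t0] := ltP t 0.
  rewrite integral0 delta_outside// => p [_ /=]; rewrite !in_itv/= => pt.
  by split => //; rewrite leNgt (le_lt_trans pt).
pose s := Num.min t T.
have sT : 0 <= s <= T by rewrite le_min t0 (ltW T_gt0) ge_min lexx orbT.
have -> : (fun w => (if t < T then rho t w else 1)%:E) = (fun w => (rho s w)%:E).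
  apply/funext => w; rewrite /s minElt; case: ifP => // _.
  by rewrite randomized_end.
rewrite -(delta_randomizedE T_gt0 F_usual)//.
have mAs : measurable (A `*` `[0, s] : set (Omega * R)) by apply: measurableX.
have rest0 : delta ((A `*` `]-oo, t]) `\` (A `*` `[0, s])) = 0%E.
  apply: delta_outside; first exact: measurableD.
  move=> p [[Ap /=]]; rewrite !in_itv/= => pt nAs; split => //.
  move=> /andP[p0 pT]; apply: nAs; split => //.
  by rewrite p0 le_min pt.
rewrite (measureDI delta mAt mAs) [X in (X + _)%E]rest0 add0e.
congr (delta _); apply: setIidr => p [Ap /=]; rewrite !in_itv/= => /andP[_].
by rewrite le_min => /andP[].
Qed.

(** The conditional law of the stopping time given [w] has distribution function
    [randomized_cdf rho w]; both sides are measures that are computed from this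
    function on the products with a half-line. *)
Lemma delta_randomized_disintegration C : measurable C ->
  delta C = (\int[P]_w kappa w (xsection C w))%E.
Proof.
have productX (A : set Omega) (B : set R) : measurable A -> measurable B ->
    product (A `*` B) = (\int[P]_(w in A) randomized_law rho w B)%E.
  move=> mA mB; rewrite [RHS]integral_mkcond; apply: eq_integral => w _.
  rewrite patchE; case: ifPn => wA; first by rewrite in_xsectionX.
  by rewrite notin_xsectionX// measure0.
move: C; apply: (eq_measure_lower_rays (m1 := delta) (m2 := product)).
- move=> A mA; rewrite [LHS](distribution_marginal delta mA) [RHS]productX//.
  rewrite (eq_integral (cst 1%E)); last by move=> w _; exact: probability_setT.
  by rewrite integral_cst// mul1e.
- move=> A t mA; rewrite [LHS]delta_ray// [RHS]productX//.
  by apply: eq_integral => w _; rewrite law_itvNyc.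
Qed.

Lemma payoff_randomized_distribution (X : stopping_problem Omega T) :
  payoff_randomized X rho = payoff_distribution X delta.
Proof.
rewrite payoff_distributionE.
rewrite (integral_disintegration (k := kappa) delta_randomized_disintegration).
  apply: eq_integral => w _; rewrite [LHS]integral_mkcond.
  apply: eq_integral => t _.
  by rewrite /payoff_fun !patchE in_setX/= in_setT.
exact: (integrable_payoff_fun_comp X delta (@measurable_id _ _ setT)).
Qed.

End randomized.

Theorem theorem3 (d : measure_display) (Omega : measurableType d)
    (R : realType) (P : probability Omega R) (T : R) (T_gt0 : 0 < T)
    (F : filtration Omega T) (F_usual : usual_conditions P F)
    (X : stopping_problem Omega T) :
  [/\ forall (mu : mixed_stopping_time P F) (rho : randomized_stopping_time P F),
        equivalent T_gt0 F_usual mu rho ->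
        payoff_mixed X mu = payoff_randomized X rho,
      forall mu : mixed_stopping_time P F,
        payoff_mixed X mu = payoff_distribution X (delta_mixed mu) &
      forall rho : randomized_stopping_time P F,
        payoff_randomized X rho =
        payoff_distribution X (delta_randomized T_gt0 F_usual rho)].
Proof.
split; [|exact: payoff_mixed_distribution|].
- move=> mu rho mu_rho.
  rewrite payoff_mixed_distribution payoff_randomized_distribution.
  rewrite !payoff_distributionE; apply: eq_measure_integral => C mC _.
  exact: mu_rho.
- by move=> rho; exact: payoff_randomized_distribution.
Qed.
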